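(* The pointwise topology is contained in every $T_1$ topology that is semitopological for the endomorphism monoid of each of the following structures: (i) $(\mathbb{Q},\leq)$; (ii) the random reflexive partial order; (iii) the random graph with loops; (iv) the random directed graph with loops; (v) $n\mathbb{K}_m$ with loops for every $1\leq n,m\leq\omega$ such that either $n=\omega$ or $m=\omega$.
   Context: A topology on a semigroup $S$ is semitopological for $S$ if for every $x\in S$ the maps $y\mapsto xy$ and $y\mapsto yx$ from $S$ to $S$ are continuous. The pointwise topology on the endomorphism monoid $\operatorname{End}(\mathbb{X})$ of a structure with domain $X$ has subbasis the sets $\{f : (x)f=y\}$, $x,y\in X$, where $(x)f$ denotes the image of $x$ under $f$. The random reflexive partial order is the Fra\''iss\'e limit of the class of all finite (reflexive) partial orders. The random graph and random directed graph are the Fra\''iss\'e limits of the classes of all finite loopless undirected graphs and of all finite directed graphs, respectively, where a directed graph is a set with an irreflexive binary relation that need not be symmetric or antisymmetric. $\mathbb{K}_m$ is the complete graph on $m$ vertices and $n\mathbb{K}_m$ is the disjoint union of $n$ copies of $\mathbb{K}_m$. ''With loops'' means that all pairs $(x,x)$ are added to the relation. *)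

(* Defs.v *)
From HB Require Import structures.
From mathcomp Require Import all_boot all_order all_algebra.
From mathcomp Require Import all_classical topology.

Set Implicit Arguments.
Unset Strict Implicit.
Unset Printing Implicit Defensive.

Local Open Scope classical_set_scope.

(* Structures with one binary relation are given by the relation
   [R : X -> X -> Prop] on the domain [X]. *)

Record endo (X : Type) (R : X -> X -> Prop) := Endo {
  endo_fun :> X -> X;
  endo_hom : forall x y, R x y -> R (endo_fun x) (endo_fun y) }.

Section EndoMonoid.
Variables (X : Type) (R : X -> X -> Prop).

Lemma endo_ext (f g : endo R) : f =1 g -> f = g.
Proof.
case: f g => [f hf] [g hg] /= /funext fg; subst g.
by congr Endo; exact: Prop_irrelevance.
Qed.

HB.instance Definition _ := gen_eqMixin (endo R).
HB.instance Definition _ := gen_choiceMixin (endo R).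

Definition endo_one : endo R := @Endo X R idfun (fun x y h => h).

(* Functions act on the right: (x)(fg) = ((x)f)g. *)
Definition endo_mul (f g : endo R) : endo R :=
  @Endo X R (g \o f) (fun x y h => endo_hom g (endo_hom f h)).

Lemma endo_mulA : associative endo_mul.
Proof. by move=> f g h; apply: endo_ext. Qed.

Lemma endo_mul1f : left_id endo_one endo_mul.
Proof. by move=> f; apply: endo_ext. Qed.

Lemma endo_mulf1 : right_id endo_one endo_mul.
Proof. by move=> f; apply: endo_ext. Qed.

HB.instance Definition _ :=
  isMonoid.Build (endo R) endo_mulA endo_mul1f endo_mulf1.

(* The canonical topology on [endo R] is the pointwise topology. *)
Definition pointwise_subbase : set (set (endo R)) :=
  [set A | exists x y, A = [set f : endo R | f x = y]].

HB.instance Definition _ :=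
  isSubBaseTopological.Build (endo R) pointwise_subbase id.

End EndoMonoid.

Definition semitopological (S : semigroupType) (t : Topological S) : Prop :=
  let T := Topological.Pack t in
  forall x : S, continuous ((fun y : S => (x * y)%g) : T -> T) /\
                continuous ((fun y : S => (y * x)%g) : T -> T).

Definition pointwise_in_every_T1_semitopological
    (X : Type) (R : X -> X -> Prop) : Prop :=
  forall t : Topological (endo R),
    accessible_space (Topological.Pack t) ->
    semitopological t ->
    forall U : set (endo R), open U -> @open (Topological.Pack t) U.

Definition embeds (X Y : Type) (R : X -> X -> Prop) (S : Y -> Y -> Prop) :=
  exists2 f : X -> Y, injective f & forall x y, R x y <-> S (f x) (f y).

Definition automorphism (X : Type) (R : X -> X -> Prop) (g : X -> X) :=
  bijective g /\ forall x y, R x y <-> R (g x) (g y).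

Definition homogeneous (X : Type) (R : X -> X -> Prop) :=
  forall (A B : set X) (p : X -> X),
    finite_set A -> set_bij A B p ->
    (forall x y, A x -> A y -> (R x y <-> R (p x) (p y))) ->
    exists2 g, automorphism R g & forall x, A x -> g x = p x.

Definition finite_class := forall A : finType, (A -> A -> Prop) -> Prop.

(* The Fraisse limit is unique up to isomorphism; this predicate
   characterises it. *)
Definition fraisse_limit (K : finite_class) (X : Type) (R : X -> X -> Prop) :=
  [/\ countable [set: X],
      homogeneous R &
      forall (A : finType) (S : A -> A -> Prop), K A S <-> embeds S R].

Definition finite_partial_order : finite_class := fun A R =>
  [/\ forall x, R x x,
      forall x y, R x y -> R y x -> x = y &
      forall x y z, R x y -> R y z -> R x z].

Definition finite_graph : finite_class := fun A R =>
  (forall x, ~ R x x) /\ (forall x y, R x y -> R y x).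

Definition finite_digraph : finite_class := fun A R => forall x, ~ R x x.

Definition with_loops (X : Type) (R : X -> X -> Prop) (x y : X) : Prop :=
  R x y \/ x = y.

(* Cardinals n <= omega. *)
Inductive cardinal := Fin of nat | Omega.

Definition one_le (c : cardinal) : Prop :=
  if c is Fin n then is_true (1 <= n)%N else True.

Definition carrier (c : cardinal) : Type :=
  if c is Fin n then 'I_n else nat.

Definition complete_graph (m : cardinal) (x y : carrier m) : Prop := x <> y.

Definition copies (n : cardinal) (X : Type) (R : X -> X -> Prop)
    (u v : carrier n * X) : Prop :=
  u.1 = v.1 /\ R u.2 v.2.

(* Main.v *)
Require Import Defs.
From mathcomp Require Import all_boot all_order all_algebra.
From mathcomp Require Import all_classical topology.

(** In these structures every constant map c_x is an endomorphism, and
    c_x f g = c_z if and only if ((x)f)g = z.  Hence in a T1 semitopological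
    topology {f | ((x)f)g <> z} is open for every endomorphism g.  Taking for g
    two-valued endomorphisms one reaches {f | (x)f = y}: if the relation contains
    a 2-cycle (or is equality), all maps into a suitable pair are endomorphisms,
    in particular the indicator of {y}; in a nontrivial partial order the
    indicators of the up-set and of the down-set of y suffice, since these meet in {y}. *)

Set Implicit Arguments.
Unset Strict Implicit.
Unset Printing Implicit Defensive.

Import Order.TTheory.

Local Open Scope classical_set_scope.

Definition endo_cst (X : Type) (R : X -> X -> Prop) (reflR : forall x, R x x)
    (x : X) : endo R :=
  @Endo X R (fun=> x) (fun _ _ _ => reflR x).

Lemma pointwise_subbase_open (X : Type) (R : X -> X -> Prop) :
  (forall (t : Topological (endo R)),
    accessible_space (Topological.Pack t) -> semitopological t ->
    forall x y, @open (Topological.Pack t) [set f : endo R | f x = y]) ->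
  pointwise_in_every_T1_semitopological R.
Proof.
move=> subo t T1 st U [D' sD' <-].
apply: (@bigcup_open (Topological.Pack t)) => A /sD' [F sF <-].
(* A basic open set is a finite intersection of subbasic ones; as an iterated operation over a
   finite list it is handled by induction. *)
rewrite bigcap_fset big_seq.
elim/big_ind: _ => [|B C oB oC|B /sF].
- exact: (@openT (Topological.Pack t)).
- exact: (@openI (Topological.Pack t)).
- by rewrite inE => -[x [y ->]]; exact: subo.
Qed.

Lemma open_image_neq (X : Type) (R : X -> X -> Prop)
    (reflR : forall x, R x x) (t : Topological (endo R))
    (T1 : accessible_space (Topological.Pack t)) (st : semitopological t)
    (x z : X) (g : endo R) :
  @open (Topological.Pack t) [set f : endo R | g (f x) <> z].
Proof.
set T := Topological.Pack t.
have cf : continuous ((fun f => endo_mul (endo_cst reflR x) f) : T -> T).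
  by case: (st (endo_cst reflR x)).
have cg : continuous ((fun f => endo_mul f g) : T -> T) by case: (st g).
have oz : @open T (~` [set endo_cst reflR z]).
  exact/closed_openC/accessible_closed_set1.
(* Pulling the complement of the closed point c_z back along right translation by [g], then left
   translation by c_x, gives the set of [f] with c_x f g distinct from c_z. *)
have := (continuousP _).1 cf _ ((continuousP _).1 cg _ oz).
congr (@open T _); apply/seteqP; split=> f /= fz.
- by move=> gfxz; apply: fz; apply: endo_ext.
- by move=> /(congr1 (fun h : endo R => h x)).
Qed.

(** The endomorphism [g] with value [b] on [P] and [a] off [P] avoids [a] exactly on [P] and avoids
    [b] exactly off [P]. *)
Lemma open_two_valued (X : Type) (R : X -> X -> Prop)
    (reflR : forall x, R x x) (t : Topological (endo R))
    (T1 : accessible_space (Topological.Pack t)) (st : semitopological t)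
    (a b : X) (P : X -> Prop) (x : X) :
  a <> b ->
  (forall u v, R u v ->
    R (if `[< P u >] then b else a) (if `[< P v >] then b else a)) ->
  @open (Topological.Pack t) [set f : endo R | P (f x)] /\
  @open (Topological.Pack t) [set f : endo R | ~ P (f x)].
Proof.
move=> ab homP; have oneq z := open_image_neq reflR T1 st x z (Endo homP).
split.
- have := oneq a; congr open; apply/seteqP; split=> f /=.
  + by case: asboolP.
  + by move=> /asboolT -> /esym.
- have := oneq b; congr open; apply/seteqP; split=> f /=.
  + by case: asboolP.
  + by move=> /asboolF ->.
Qed.

Lemma T1_semitopological_two_cycle (X : Type) (R : X -> X -> Prop) (a b : X) :
  (forall x, R x x) -> a <> b -> R a b -> R b a ->
  pointwise_in_every_T1_semitopological R.
Proof.
move=> reflR ab Rab Rba; apply: pointwise_subbase_open => t T1 st x y.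
have [|] // := open_two_valued reflR T1 st (P := eq^~ y) x ab.
by move=> u v _; case: asboolP; case: asboolP.
Qed.

(** This serves one-vertex copies, where only the loops remain. On a domain with at most one point
    each subbasic set is the whole monoid. *)
Lemma T1_semitopological_eq (X : Type) :
  pointwise_in_every_T1_semitopological (@eq X).
Proof.
apply: pointwise_subbase_open => t T1 st x y.
have [[a [b ab]]|sub] := pselect (exists a b : X, a <> b).
  have [|] // := open_two_valued (@erefl X) T1 st (P := eq^~ y) x ab.
  by move=> u v ->.
rewrite [X in open X](_ : _ = setT); first exact: openT.
apply/seteqP; split=> f //= _; apply: contrapT => fxy.
by apply: sub; exists (f x), y.
Qed.

Lemma T1_semitopological_poset (X : Type) (R : X -> X -> Prop) (a b : X) :
  (forall x, R x x) -> (forall x y, R x y -> R y x -> x = y) ->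
  (forall x y z, R x y -> R y z -> R x z) -> a <> b -> R a b ->
  pointwise_in_every_T1_semitopological R.
Proof.
move=> reflR antiR transR ab Rab; apply: pointwise_subbase_open => t T1 st x y.
have [u v Ruv|oup _] := open_two_valued reflR T1 st (P := R y) x ab.
  case: asboolP => Ryu; case: asboolP => // nRyv.
  by case: nRyv; exact: transR Ruv.
(* Since [a] lies below [b], the value [b] must be taken on an up-closed set: hence the complement
   of the down-set of [y], whose second open set is the wanted one up to a double negation. *)
have [u v Ruv|_ odown] :=
    open_two_valued reflR T1 st (P := fun u => ~ R u y) x ab.
  case: asboolP => nRuy; case: asboolP => // /contrapT Rvy.
  by case: nRuy; exact: transR Rvy.
have := openI oup odown; congr open; apply/seteqP; split=> f /=.
- by move=> [Ryf /contrapT Rfy]; exact: antiR.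
- by move=> ->; split=> // /(_ (reflR y)).
Qed.

(** Each order axiom concerns at most three points, so it can be checked on the substructure they
    span. *)
Lemma finitely_partial_order (T : choiceType) (R : T -> T -> Prop) :
  (forall s : seq T,
    finite_partial_order (fun u v : seq_sub s => R (val u) (val v))) ->
  [/\ forall x, R x x, forall x y, R x y -> R y x -> x = y &
      forall x y z, R x y -> R y z -> R x z].
Proof.
move=> sub; split.
- move=> x; have [refl _ _] := sub [:: x].
  exact: refl (SeqSub (mem_head x [::])).
- move=> x y Rxy Ryx; have [_ anti _] := sub [:: x; y].
  have yI : y \in [:: x; y] by rewrite !inE eqxx orbT.
  exact: (congr1 val (anti (SeqSub (mem_head x _)) (SeqSub yI) Rxy Ryx)).
- move=> x y z; have [_ _ trans] := sub [:: x; y; z].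
  have yI : y \in [:: x; y; z] by rewrite !inE eqxx orbT.
  have zI : z \in [:: x; y; z] by rewrite !inE eqxx !orbT.
  exact: trans (SeqSub (mem_head x _)) (SeqSub yI) (SeqSub zI).
Qed.

Lemma fraisse_limit_poset (X : Type) (R : X -> X -> Prop) :
  fraisse_limit finite_partial_order R ->
  [/\ forall x, R x x, forall x y, R x y -> R y x -> x = y &
      forall x y z, R x y -> R y z -> R x z].
Proof.
(* [{classic X}] equips [X] with the choice structure that [seq_sub] requires. *)
move=> [_ _ age]; apply: (@finitely_partial_order {classic X} R) => s.
by apply/age; exists val => //; exact: val_inj.
Qed.

(** Disequality on [bool] is the complete graph on two vertices, which is both a finite graph and a
    finite digraph. *)
Lemma age_two_cycle (X : Type) (R : X -> X -> Prop) :
  embeds (fun x y : bool => x <> y) R ->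
  pointwise_in_every_T1_semitopological (with_loops R).
Proof.
move=> [f finj fR].
apply: (@T1_semitopological_two_cycle _ _ (f true) (f false)).
- by right.
- by move/finj.
- by left; apply/fR.
- by left; apply/fR.
Qed.

Theorem theorem3p3 :
  [/\ pointwise_in_every_T1_semitopological (fun x y : rat => (x <= y)%R : Prop),
      forall (X : Type) (R : X -> X -> Prop),
        fraisse_limit finite_partial_order R ->
        pointwise_in_every_T1_semitopological R,
      forall (X : Type) (R : X -> X -> Prop),
        fraisse_limit finite_graph R ->
        pointwise_in_every_T1_semitopological (with_loops R),
      forall (X : Type) (R : X -> X -> Prop),
        fraisse_limit finite_digraph R ->
        pointwise_in_every_T1_semitopological (with_loops R) &
      forall n m : cardinal,
        one_le n -> one_le m -> n = Omega \/ m = Omega ->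
        pointwise_in_every_T1_semitopological
          (with_loops (copies (n := n) (@complete_graph m)))].
Proof.
split.
- apply: (@T1_semitopological_poset _ _ 0%R 1%R) => //.
  + by move=> x y xy yx; apply/le_anti/andP.
  + by move=> x y z; exact: le_trans.
- move=> X R lim; have [reflR antiR transR] := fraisse_limit_poset lim.
  have [_ _ age] := lim.
  (* Implication makes [bool] the two-element chain; its image supplies a comparable pair of
     distinct points. *)
  have [|f finj fR] := (age bool (fun x y : bool => x ==> y)).1.
    by split; [case|case; case|case; case; case].
  apply: (@T1_semitopological_poset _ _ (f false) (f true)) => //.
  + by move/finj.
  + exact/fR.
- move=> X R [_ _ age]; apply/age_two_cycle/age.
  by split=> [x|x y xy yx]; [|apply: xy].
- by move=> X R [_ _ age]; apply/age_two_cycle/age => x.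
- move=> n m n1 m1 _.
  have [[i]|noX] := pselect (inhabited (carrier n)); last first.
    apply: pointwise_subbase_open => t T1 st x.
    by case: noX; case: x => i _; exists.
  (* Two distinct vertices of one copy form a 2-cycle; otherwise there are no edges, and adding
     loops yields equality. *)
  have [[a [b ab]]|sub] := pselect (exists a b : carrier m, a <> b).
    apply: (@T1_semitopological_two_cycle _ _ (i, a) (i, b)).
    + by right.
    + by case.
    + by left.
    + by left; split=> // /esym.
  rewrite [with_loops _](_ : _ = eq); first exact: T1_semitopological_eq.
  apply/funext => u; apply/funext => v; apply/propext; split; last by right.
  by case=> // -[_ uv]; case: sub; exists u.2, v.2.
Qed.
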